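(* Suppose $(\lambda_*,z_* )$ is a minimizer of QEPmin. Then a minimizer $v_*$ of CRQopt is given by $v_*=n_0-\frac{\gamma^2}{b_0^{\top}z_*}(PAP-\lambda_*I)z_*$ if $b_0^{\top}z_*\neq0$, and $v_*=n_0+x_*+\sqrt{\gamma^2-\|x_*\|^2}\,\frac{z_*}{\|z_*\|}$ if $b_0^{\top}z_*=0$, where in the latter case $x_*=-(PAP-\lambda_*I)^{\dagger}b_0$, and it is guaranteed that $\|x_*\|\le\gamma$.
   Context: Let $A\in\mathbb{R}^{n\times n}$ be symmetric, $C\in\mathbb{R}^{n\times m}$ ($m<n$) full column rank, $b\in\mathbb{R}^m$, $n_0=C(C^{\top}C)^{-1}b$ with $\|n_0\|<1$, $\gamma=\sqrt{1-\|n_0\|^2}$, $P=I-C(C^{\top}C)^{-1}C^{\top}$ (orthogonal projector onto $\mathcal N(C^{\top})$), $b_0=PAn_0$, assumed nonzero. $X^\dagger$ is the Moore–Penrose inverse. CRQopt: minimize $v^{\top}Av$ over $v\in\mathbb{R}^n$ subject to $v^{\top}v=1$ and $C^{\top}v=b$. QEPmin: minimize $\lambda$ over pairs $(\lambda,z)$ with $\lambda\in\mathbb{R}$, $0\neq z\in\mathcal N(C^{\top})$ and $(PAP-\lambda I)^2z=\gamma^{-2}b_0b_0^{\top}z$. *)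

(* Defs.v *)
From HB Require Import structures.
From mathcomp Require Import all_boot all_order all_algebra.
Set Implicit Arguments.
Unset Strict Implicit.
Unset Printing Implicit Defensive.
Import Order.TTheory GRing.Theory Num.Theory.
Local Open Scope ring_scope.

Section Defs.
Variable R : rcfType.

Definition sqnorm (k : nat) (v : 'cV[R]_k) : R := (v^T *m v) 0 0.
Definition vnorm (k : nat) (v : 'cV[R]_k) : R := Num.sqrt (sqnorm v).

Definition is_mpinv (p q : nat) (M : 'M[R]_(p, q)) (X : 'M[R]_(q, p)) : Prop :=
  [/\ M *m X *m M = M, X *m M *m X = X,
      (M *m X)^T = M *m X & (X *m M)^T = X *m M].

Variables (n m : nat).

Definition n0 (C : 'M[R]_(n, m)) (b : 'cV[R]_m) : 'cV[R]_n :=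
  C *m invmx (C^T *m C) *m b.
Definition gam (C : 'M[R]_(n, m)) (b : 'cV[R]_m) : R :=
  Num.sqrt (1 - sqnorm (n0 C b)).
Definition projP (C : 'M[R]_(n, m)) : 'M[R]_n :=
  1%:M - C *m invmx (C^T *m C) *m C^T.
Definition b0 (A : 'M[R]_n) (C : 'M[R]_(n, m)) (b : 'cV[R]_m) : 'cV[R]_n :=
  projP C *m A *m n0 C b.

Definition CRQ_feasible (C : 'M[R]_(n, m)) (b : 'cV[R]_m) (v : 'cV[R]_n) : Prop :=
  sqnorm v = 1 /\ C^T *m v = b.
Definition CRQ_obj (A : 'M[R]_n) (v : 'cV[R]_n) : R := (v^T *m A *m v) 0 0.
Definition CRQ_minimizer (A : 'M[R]_n) (C : 'M[R]_(n, m)) (b : 'cV[R]_m)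
    (v : 'cV[R]_n) : Prop :=
  CRQ_feasible C b v /\
  forall w, CRQ_feasible C b w -> CRQ_obj A v <= CRQ_obj A w.

Definition QEP_feasible (A : 'M[R]_n) (C : 'M[R]_(n, m)) (b : 'cV[R]_m)
    (lam : R) (z : 'cV[R]_n) : Prop :=
  let M := projP C *m A *m projP C - lam%:M in
  [/\ z != 0, C^T *m z = 0 &
      M *m (M *m z) = (gam C b ^- 2) *: (b0 A C b *m (b0 A C b)^T *m z)].
Definition QEP_minimizer (A : 'M[R]_n) (C : 'M[R]_(n, m)) (b : 'cV[R]_m)
    (lam : R) (z : 'cV[R]_n) : Prop :=
  QEP_feasible A C b lam z /\
  forall lam' z', QEP_feasible A C b lam' z' -> lam <= lam'.

End Defs.

(* Main.v *)
(* Writing v = n0 + x with x in N(C^T), the objective becomes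
   x^T H x + 2 b0^T x plus a constant, H = PAP, on the sphere |x| = gamma. If
   H - lam is positive semidefinite on N(C^T) and (H - lam) x = -b0, then x is a
   global minimizer, so the point is that the least QEP eigenvalue lam does not
   exceed the spectrum d_i of H on N(C^T). In an eigenbasis, with beta the
   coordinates of b0, any root lam < min d_i of the secular equation
   sum_i beta_i^2 / (d_i - lam)^2 = gamma^2 is a QEP eigenvalue; such a root
   exists by the intermediate value theorem as soon as the left-hand side
   reaches gamma^2 left of min d_i, in particular when some beta_j <> 0 with
   d_j = min d_i, while if such a beta_j vanishes d_j itself is a QEP
   eigenvalue. Minimality of lam then also gives b0 in the range of H - lam on
   N(C^T), with a preimage of norm at most gamma, and the pseudo-inverse
   solution is the shortest preimage. *)
Require Import Defs.
From HB Require Import structures.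
From mathcomp Require Import all_boot all_order all_algebra.
From mathcomp Require Import complex ring lra.
Set Implicit Arguments.
Unset Strict Implicit.
Unset Printing Implicit Defensive.
Import Order.TTheory GRing.Theory Num.Theory.
Local Open Scope ring_scope.

(** * The Euclidean inner product on column vectors *)

Definition dot (R : rcfType) (k : nat) (u v : 'cV[R]_k) : R := (u^T *m v) 0 0.

Section Dot.
Variables (R : rcfType) (k : nat).
Implicit Types u v w : 'cV[R]_k.

Lemma dotE u v : dot u v = \sum_i u i 0 * v i 0.
Proof. by rewrite /dot mxE; apply: eq_bigr => i _; rewrite mxE. Qed.

Lemma dotC u v : dot u v = dot v u.
Proof. by rewrite !dotE; apply: eq_bigr => i _; rewrite mulrC. Qed.

Lemma dotDr u v w : dot u (v + w) = dot u v + dot u w.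
Proof. by rewrite /dot mulmxDr mxE. Qed.

Lemma dotZr a u v : dot u (a *: v) = a * dot u v.
Proof. by rewrite /dot -scalemxAr mxE. Qed.

Lemma dotNr u v : dot u (- v) = - dot u v.
Proof. by rewrite /dot mulmxN mxE. Qed.

Lemma dotDl u v w : dot (u + v) w = dot u w + dot v w.
Proof. by rewrite ![dot _ w]dotC dotDr. Qed.

Lemma dotZl a u v : dot (a *: u) v = a * dot u v.
Proof. by rewrite ![dot _ v]dotC dotZr. Qed.

Lemma dotNl u v : dot (- u) v = - dot u v.
Proof. by rewrite ![dot _ v]dotC dotNr. Qed.

Lemma dot0l v : dot 0 v = 0.
Proof. by rewrite /dot trmx0 mul0mx mxE. Qed.

Lemma dot0r v : dot v 0 = 0.
Proof. by rewrite dotC dot0l. Qed.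

Lemma mulmx_dot u v : u^T *m v = (dot u v)%:M.
Proof. exact: mx11_scalar. Qed.

Lemma mulmx_outer u v w : u *m v^T *m w = dot v w *: u.
Proof. by rewrite -mulmxA mulmx_dot mul_mx_scalar. Qed.

Lemma dot_ge0 u : 0 <= dot u u.
Proof. by rewrite dotE sumr_ge0 // => i _; rewrite -expr2 sqr_ge0. Qed.

Lemma dot_eq0 u : (dot u u == 0) = (u == 0).
Proof.
rewrite dotE; apply/eqP/eqP => [/eqP | -> ]; last first.
  by rewrite big1 // => i _; rewrite mxE mul0r.
rewrite psumr_eq0 => [/allP u0 | i _]; last by rewrite -expr2 sqr_ge0.
apply/colP => i; rewrite mxE; apply/eqP.
by rewrite -[_ == 0]orbb -mulf_eq0; apply: u0; rewrite mem_index_enum.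
Qed.

End Dot.

Lemma dot_mulmx (R : rcfType) (p q : nat) (M : 'M[R]_(p, q)) u v :
  dot u (M *m v) = dot (M^T *m u) v.
Proof. by rewrite /dot trmx_mul trmxK mulmxA. Qed.

(** * Real symmetric spectral theorem on the range of an orthogonal projector *)

Section Spectral.
Variable R : rcfType.

(* A complex eigenvector of a real matrix splits into its real and imaginary
   parts, which span an invariant real subspace. *)
Lemma real_invariant_pair (r : nat) (K : 'M[R]_r) : (0 < r)%N ->
  exists x y : 'rV[R]_r, exists a b : R,
    [/\ (x != 0) || (y != 0), x *m K = a *: x - b *: y
      & y *m K = b *: x + a *: y].
Proof.
move=> r_gt0; pose KC : 'M[R[i]]_r := map_mx (real_complex R) K.
have /closed_rootP[c] : size (char_poly KC) != 1%N.
  by rewrite size_char_poly; case: (r) r_gt0.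
rewrite -eigenvalue_root_char => /eigenvalueP[w wK w_neq0].
exists (map_mx (@complex.Re R) w), (map_mx (@complex.Im R) w).
exists (complex.Re c), (complex.Im c).
have ReD : {morph (@complex.Re R) : x y / x + y} by case=> ? ? [].
have ImD : {morph (@complex.Im R) : x y / x + y} by case=> ? ? [].
split.
- apply: contraR w_neq0; rewrite negb_or !negbK => /andP[/eqP x0 /eqP y0].
  apply/eqP/rowP => i; rewrite !mxE.
  move/rowP/(_ i): x0; move/rowP/(_ i): y0; rewrite !mxE.
  by case: (w 0 i) => ? ? /= -> ->.
- apply/rowP => j; move/rowP/(_ j): wK => /(congr1 (@complex.Re R)).
  rewrite !mxE (big_morph _ ReD (erefl _)) => wK.
  transitivity (complex.Re (c * w 0 j)); last first.
    by case: (c) (w 0 j) => ? ? [].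
  rewrite -wK; apply: eq_bigr => i _; rewrite !mxE.
  by case: (w 0 i) => ? ? /=; rewrite mulr0 subr0.
- apply/rowP => j; move/rowP/(_ j): wK => /(congr1 (@complex.Im R)).
  rewrite !mxE (big_morph _ ImD (erefl _)) => wK.
  transitivity (complex.Im (c * w 0 j)); last first.
    by case: (c) (w 0 j) => ? ? [] /= ? ?; rewrite addrC.
  rewrite -wK; apply: eq_bigr => i _; rewrite !mxE.
  by case: (w 0 i) => ? ? /=; rewrite mulr0 add0r.
Qed.

(** Commutation makes the row space of [P] invariant under [H], so [H] acts on a row basis of [P]
    through a matrix [K]. An invariant pair of [K] lifts to [X], [Y], and symmetry of [H] forces the
    imaginary part of the eigenvalue to vanish. *)
Lemma sym_eigenvector (n : nat) (P H : 'M[R]_n) :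
  P^T = P -> H^T = H -> P *m H = H *m P -> P != 0 ->
  exists (u : 'cV[R]_n) (a : R),
    [/\ dot u u = 1, (u^T <= P)%MS & H *m u = a *: u].
Proof.
move=> Psym Hsym PH P_neq0.
have r_gt0 : (0 < \rank P)%N by rewrite lt0n mxrank_eq0.
pose B := row_base P.
have /submxP[K BH] : (B *m H <= B)%MS.
  rewrite (eqmxMr H (eq_row_base P)) eq_row_base PH.
  by rewrite submxMl.
have [x [y [a [b [xy_neq0 xK yK]]]]] := real_invariant_pair K r_gt0.
pose X := (x *m B)^T; pose Y := (y *m B)^T.
have HX : H *m X = a *: X - b *: Y.
  rewrite /X /Y -[H in LHS]Hsym -trmx_mul -mulmxA BH mulmxA xK mulmxBl.
  by rewrite -!scalemxAl linearB /= !linearZ.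
have HY : H *m Y = b *: X + a *: Y.
  rewrite /X /Y -[H in LHS]Hsym -trmx_mul -mulmxA BH mulmxA yK mulmxDl.
  by rewrite -!scalemxAl linearD /= !linearZ.
have Bfree : row_free B by exact: row_base_free.
have XY_neq0 : (X != 0) || (Y != 0).
  by rewrite !trmx_eq0 !mulmx_free_eq0.
have b0 : b = 0.
  have : dot X (H *m Y) = dot (H *m X) Y by rewrite dot_mulmx Hsym.
  rewrite HX HY dotDr dotDl dotNl !dotZr !dotZl => E.
  have /eqP : b * (dot X X + dot Y Y) = 0.
    by move/eqP: E; rewrite -subr_eq0 => /eqP <-; ring.
  rewrite mulf_eq0 paddr_eq0 ?dot_ge0 // !dot_eq0.
  by case/orP => [/eqP //|/andP[X0 Y0]]; rewrite X0 Y0 in XY_neq0.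
suff [V [V_neq0 VP HV]] : exists V : 'cV[R]_n,
    [/\ V != 0, (V^T <= P)%MS & H *m V = a *: V].
  have dV_gt0 : 0 < dot V V by rewrite lt0r dot_eq0 V_neq0 dot_ge0.
  exists ((Num.sqrt (dot V V))^-1 *: V), a; split.
  - rewrite dotZl dotZr mulrA -invfM -expr2 sqr_sqrtr ?ltW //.
    by rewrite mulVf ?gt_eqF.
  - by rewrite linearZ /= scalemx_sub.
  - by rewrite -scalemxAr HV !scalerA mulrC.
rewrite b0 scale0r in HX HY; rewrite scale0r in HX HY.
have subP w : ((w *m B)^T^T <= P)%MS.
  by rewrite trmxK -(eq_row_base P) submxMl.
case/orP: XY_neq0 => neq0.
  by exists X; split; rewrite // ?subP // HX subr0.
by exists Y; split; rewrite // ?subP // HY add0r.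
Qed.

(** Induction on the rank: for a unit eigenvector [u] in the range of [P], the matrix [P - u *m u^T]
    is again an orthogonal projector commuting with [H], of smaller rank. *)
Lemma sym_spectral (n : nat) (P H : 'M[R]_n) :
  P^T = P -> P *m P = P -> H^T = H -> P *m H = H *m P ->
  exists (k : nat) (U : 'M[R]_(n, k)) (d : 'rV[R]_k),
    [/\ U^T *m U = 1%:M, U *m U^T = P & H *m U = U *m diag_mx d].
Proof.
move: {2}(\rank P) (leqnn (\rank P)) => r.
elim: r P => [|r IHr] P leP Psym Pid Hsym PH.
  move: leP; rewrite leqn0 mxrank_eq0 => /eqP->.
  exists 0%N, 0, 0; split; last by rewrite mulmx0 mul0mx.
    by apply/matrixP => -[].
  by rewrite mul0mx.
have [->|P_neq0] := eqVneq P 0.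
  exists 0%N, 0, 0; split; last by rewrite mulmx0 mul0mx.
    by apply/matrixP => -[].
  by rewrite mul0mx.
have [u [a [uu uP Hu]]] := sym_eigenvector Psym Hsym PH P_neq0.
have Pu : P *m u = u.
  have /submxP[w uE] := uP.
  by apply: trmx_inj; rewrite trmx_mul Psym uE -mulmxA Pid.
have uTP : u^T *m P = u^T by rewrite -[P]Psym -trmx_mul Pu.
have uTH : u^T *m H = a *: u^T.
  by rewrite -[H]Hsym -trmx_mul Hu linearZ.
have uTu : u^T *m u = 1%:M by rewrite mulmx_dot uu.
pose P' := P - u *m u^T.
have P'sym : P'^T = P' by rewrite /P' linearB /= trmx_mul trmxK Psym.
have P'u : P' *m u = 0.
  by rewrite mulmxBl Pu -mulmxA uTu mulmx1 subrr.
have P'P : P' *m P = P' by rewrite mulmxBl Pid -mulmxA uTP.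
have P'id : P' *m P' = P'.
  by rewrite {2}/P' mulmxBr P'P mulmxA P'u mul0mx subr0.
have P'H : P' *m H = H *m P'.
  rewrite mulmxBl mulmxBr PH -mulmxA uTH mulmxA Hu.
  by rewrite -scalemxAl -scalemxAr.
(* Otherwise [P = P *m P'], which kills [u], although [P] fixes the unit vector [u]. *)
have ltP' : (\rank P' < \rank P)%N.
  apply: rank_ltmx; rewrite ltmxE -{1}P'P mulmx_sub //=; last first.
  apply/negP => /submxP[W PE].
  have PE' : P = P *m P' by rewrite {1}PE -{1}P'id mulmxA -PE.
  move: uu; rewrite -{2}Pu PE' -mulmxA P'u mulmx0 dot0r => /eqP.
  by rewrite eq_sym oner_eq0.
have [k [U [d [UU UP HU]]]] :=
  IHr P' (leq_trans ltP' leP) P'sym P'id Hsym P'H.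
have P'U : P' *m U = U by rewrite -UP -mulmxA UU mulmx1.
have uU : u^T *m U = 0.
  by rewrite -P'U mulmxA -[P']P'sym -trmx_mul P'u trmx0 mul0mx.
exists (1 + k)%N, (row_mx u U), (row_mx a%:M d); split.
- rewrite tr_row_mx mul_col_row uTu uU UU.
  have -> : U^T *m u = 0 by apply: trmx_inj; rewrite trmx_mul trmxK uU trmx0.
  by rewrite -scalar_mx_block.
- by rewrite tr_row_mx mul_row_col UP addrC subrK.
- rewrite diag_mx_row mul_mx_row mul_row_block !mulmx0 addr0 add0r HU.
  have -> : diag_mx a%:M = a%:M :> 'M_1.
    by apply/matrixP => i j; rewrite !mxE !ord1.
  by rewrite mul_mx_scalar Hu.
Qed.

End Spectral.

(** * The secular equation and the QEP in eigenbasis coordinates *)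

Section Secular.
Variables (R : rcfType) (k : nat) (d beta : 'I_k -> R).

Definition secular (x : R) : R := \sum_i beta i ^+ 2 / (d i - x) ^+ 2.

(** The QEP for a diagonal matrix: [c] holds the coordinates of z in the eigenbasis. *)
Definition secular_feasible (g lam : R) (c : 'I_k -> R) : Prop :=
  (exists i, c i != 0) /\
  forall i, (d i - lam) ^+ 2 * c i = g ^- 2 * (beta i * \sum_j beta j * c j).

Lemma secularE x : secular x = \sum_(i | beta i != 0) beta i ^+ 2 / (d i - x) ^+ 2.
Proof.
rewrite /secular [RHS]big_mkcond; apply: eq_bigr => i _.
by case: eqVneq => [->|] //; rewrite expr0n mul0r.
Qed.

(* Clearing denominators turns [secular x = g] into a polynomial equation, and
   [secular] is small far to the left. *)
Lemma secular_ivt (g l1 : R) :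
    0 < g -> (forall i, beta i != 0 -> l1 < d i) -> g <= secular l1 ->
  exists2 l, l <= l1 & secular l = g.
Proof.
move=> g_gt0 ltd le_g.
pose F i : {poly R} := ((d i)%:P - 'X) ^+ 2.
pose p : {poly R} := \sum_(i | beta i != 0) beta i ^+ 2 *:
    \prod_(j | (beta j != 0) && (j != i)) F j - g *: \prod_(i | beta i != 0) F i.
have FE i x : (F i).[x] = (d i - x) ^+ 2 by rewrite !hornerE.
have F_gt0 x i : x <= l1 -> beta i != 0 -> 0 < (d i - x) ^+ 2.
  by move=> lex /ltd ltdi; rewrite exprn_gt0 // subr_gt0 (le_lt_trans lex).
pose Q x := \prod_(i | beta i != 0) (d i - x) ^+ 2.
have pE x : x <= l1 -> p.[x] = Q x * (secular x - g).
  move=> lex; rewrite !hornerE horner_sum horner_prod mulrBr.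
  rewrite (eq_bigr _ (fun i _ => FE i x)) -/(Q x) [Q x * g]mulrC; congr (_ - _).
  rewrite secularE mulr_sumr; apply: eq_bigr => i bi.
  rewrite hornerZ horner_prod (eq_bigr _ (fun j _ => FE j x)) /Q [in RHS](bigD1 i) //=.
  by rewrite [RHS]mulrC [RHS]mulrA divfK // gt_eqF // F_gt0.
have Q_gt0 x : x <= l1 -> 0 < Q x.
  by move=> lex; apply: prodr_gt0 => i bi; exact: F_gt0.
(* At distance [T] left of [l1] every denominator is at least [T ^+ 2], and
   [S <= g * T <= g * T ^+ 2] because [T >= 1]. *)
pose S := \sum_i beta i ^+ 2; pose T := 1 + S / g.
have S_ge0 : 0 <= S by apply: sumr_ge0 => i _; rewrite sqr_ge0.
have T_ge1 : 1 <= T by rewrite lerDl divr_ge0 // ltW.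
have T_gt0 : 0 < T by exact: lt_le_trans T_ge1.
have le_low : l1 - T <= l1 by rewrite gerBl ltW.
have low : secular (l1 - T) <= g.
  have : secular (l1 - T) <= S / T ^+ 2.
    rewrite secularE mulr_suml [leRHS](bigID (fun i => beta i != 0)) /=.
    rewrite -[leLHS]addr0; apply: lerD; last first.
      by apply: sumr_ge0 => i _; rewrite divr_ge0 ?sqr_ge0.
    apply: ler_sum => i bi; rewrite ler_wpM2l ?sqr_ge0 //.
    rewrite lef_pV2 ?posrE ?(F_gt0 (l1 - T)) ?exprn_gt0 //.
    by have lti := ltd i bi; rewrite lerXn2r // ?nnegrE; lra.
  move/le_trans; apply; rewrite ler_pdivrMr ?exprn_gt0 //.
  have : S <= g * T by rewrite mulrDr mulr1 mulrCA divff ?gt_eqF // mulr1; lra.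
  move/le_trans; apply; rewrite ler_wpM2l ?(ltW g_gt0) //.
  by rewrite ler_eXnr.
have [|x /andP[_ lex] /rootP] := @poly_ivt R p _ _ le_low.
  rewrite !pE //; apply/andP; split.
    by rewrite pmulr_rle0 ?Q_gt0 // subr_le0.
  by rewrite mulr_ge0 ?subr_ge0 // ltW ?Q_gt0.
rewrite pE // => /eqP; rewrite mulf_eq0 gt_eqF ?Q_gt0 //= subr_eq0 => /eqP E.
by exists x.
Qed.

(** With this [c] the sum of [beta j * c j] is [secular l], that is [g ^+ 2], which cancels the
    factor [g ^- 2]. *)
Lemma secular_root_feasible (g l : R) : 0 < g ->
    (forall i, beta i != 0 -> d i != l) -> secular l = g ^+ 2 ->
  secular_feasible g l (fun i => beta i / (d i - l) ^+ 2).
Proof.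
move=> g_gt0 neqd E.
have sumE : \sum_j beta j * (beta j / (d j - l) ^+ 2) = g ^+ 2.
  by rewrite -E; apply: eq_bigr => j _; rewrite mulrA -expr2.
have g2_neq0 : g ^+ 2 != 0 by rewrite expf_neq0 // gt_eqF.
split=> [|i].
  apply/existsP; apply: contraR g2_neq0.
  rewrite negb_exists => /forallP all0; rewrite -sumE big1 // => i _.
  by have /negPn/eqP-> := all0 i; rewrite mulr0.
rewrite sumE; have [->|bi] := eqVneq (beta i) 0; first by rewrite !(mul0r, mulr0).
have dl : d i - l != 0 by rewrite subr_eq0 neqd.
by field; rewrite dl gt_eqF.
Qed.

Lemma secular_feasible_left (g : R) (j : 'I_k) : 0 < g ->
    (forall i, d j <= d i) -> beta j != 0 ->
  exists2 l, l < d j & exists c, secular_feasible g l c.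
Proof.
move=> g_gt0 mind bj.
(* At [d j - e] the [j]-th term of the secular sum alone equals [g ^+ 2]. *)
pose e := `|beta j| / g.
have e_gt0 : 0 < e by rewrite divr_gt0 ?normr_gt0.
have ltd i : d j - e < d i by rewrite (lt_le_trans _ (mind i)) // gtrBl.
have [//||l lel E] := @secular_ivt (g ^+ 2) (d j - e) (exprn_gt0 _ g_gt0).
  have -> : g ^+ 2 = beta j ^+ 2 / (d j - (d j - e)) ^+ 2.
    rewrite opprB addrCA subrr addr0 expr_div_n real_normK ?num_real //.
    by field; rewrite bj gt_eqF.
  rewrite /secular (bigD1 j) //= lerDl sumr_ge0 // => i _.
  by rewrite divr_ge0 ?sqr_ge0.
exists l; first by rewrite (le_lt_trans lel) // gtrBl.
exists (fun i => beta i / (d i - l) ^+ 2); apply: secular_root_feasible => // i _.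
by rewrite gt_eqF // (le_lt_trans lel).
Qed.

Lemma secular_min (g lam : R) : 0 < g ->
    (forall l c, secular_feasible g l c -> lam <= l) ->
  [/\ forall i, lam <= d i, forall i, beta i != 0 -> lam < d i
    & secular lam <= g ^+ 2].
Proof.
move=> g_gt0 minlam.
have no_left j : (forall i, d j <= d i) -> d j <= lam -> beta j = 0.
  move=> mind lej; apply/eqP; apply/negP => /negP bj.
  have [l ltl [c /minlam]] := secular_feasible_left g_gt0 mind bj.
  by rewrite leNgt (lt_le_trans ltl).
have led i : lam <= d i.
  have [j _ minj] := @arg_minP _ _ _ i xpredT d isT.
  have mind i' : d j <= d i' by exact: minj.
  apply: le_trans (mind i); rewrite leNgt; apply/negP => ltj.
  have bj := no_left j mind (ltW ltj).
  (* As [beta j = 0], the [j]-th coordinate vector makes both sides vanish at [d j]. *)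
  suff /minlam : secular_feasible g (d j) (fun i => (i == j)%:R).
    by rewrite leNgt ltj.
  split=> [|i']; first by exists j; rewrite eqxx oner_eq0.
  rewrite big1 => [|i2 _]; last by case: eqVneq => [->|]; rewrite ?bj ?mul0r ?mulr0.
  by case: eqVneq => [->|]; rewrite ?subrr ?expr0n ?mul0r !mulr0.
(* If [lam = d i], then [d i] is the smallest of the [d], and [no_left] gives [beta i = 0]. *)
have ltd i : beta i != 0 -> lam < d i.
  move=> bi; rewrite lt_neqAle led andbT; apply: contra bi => /eqP E.
  by apply/eqP/no_left; rewrite -E.
(* An excess over [g ^+ 2] would give a root at or left of [lam]; minimality puts it at [lam], where
   the value is too large. *)
split=> //; rewrite leNgt; apply/negP => lt_sec.
have [l lel E] := secular_ivt (exprn_gt0 2 g_gt0) ltd (ltW lt_sec).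
have /minlam : secular_feasible g l (fun i => beta i / (d i - l) ^+ 2).
  apply: secular_root_feasible => // i bi.
  by rewrite gt_eqF // (le_lt_trans lel) ?ltd.
move=> lel'; have El : lam = l by apply/le_anti; rewrite lel lel'.
by rewrite El E ltxx in lt_sec.
Qed.

End Secular.

(** * Reduction of CRQopt and QEPmin to the null space of C^T *)

Section Reduction.
Variables (R : rcfType) (n m : nat).
Variables (A : 'M[R]_n) (C : 'M[R]_(n, m)) (b : 'cV[R]_m).
Hypothesis A_sym : A^T = A.
Hypothesis C_rank : \rank C = m.
Hypothesis n0_lt1 : vnorm (n0 C b) < 1.

Local Notation P := (projP C).
Local Notation H := (P *m A *m P).
Local Notation v0 := (n0 C b).
Local Notation r0 := (b0 A C b).
Local Notation g := (gam C b).

(** A vector [w] killed by [C^T *m C] satisfies |Cw|^2 = 0, and full column rank then gives w =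
    0. *)
Lemma gram_unit : C^T *m C \in unitmx.
Proof.
rewrite -row_free_unit -kermx_eq0; apply/eqP/row_matrixP => i.
rewrite row0; apply: trmx_inj; apply/eqP; rewrite trmx0.
set w := (row i (kermx _))^T.
have Gw : C^T *m C *m w = 0.
  by apply: trmx_inj; rewrite !trmx_mul !trmxK -row_mul mulmx_ker row0 trmx0.
have : dot (C *m w) (C *m w) = 0.
  by rewrite dot_mulmx mulmxA Gw dot0l.
move/eqP; rewrite dot_eq0 => /eqP Cw.
have Ctfree : row_free C^T by rewrite /row_free mxrank_tr C_rank.
rewrite -trmx_eq0 -(mulmx_free_eq0 _ Ctfree) -trmx_mul Cw trmx0.
exact: eqxx.
Qed.

Lemma trC_n0 : C^T *m v0 = b.
Proof. by rewrite /n0 !mulmxA mulmxV ?gram_unit // mul1mx. Qed.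

Lemma trC_projP : C^T *m P = 0.
Proof.
by rewrite mulmxBr mulmx1 !mulmxA mulmxV ?gram_unit // mul1mx subrr.
Qed.

Lemma projP_sym : P^T = P.
Proof.
by rewrite linearB /= trmx1 !trmx_mul trmxK trmx_inv trmx_mul trmxK mulmxA.
Qed.

Lemma projP_id (p : nat) (Z : 'M[R]_(n, p)) : C^T *m Z = 0 -> P *m Z = Z.
Proof. by move=> CZ; rewrite mulmxBl mul1mx -!mulmxA CZ !mulmx0 subr0. Qed.

Lemma projP_idem : P *m P = P.
Proof. exact: projP_id trC_projP. Qed.

Lemma trC_b0 : C^T *m r0 = 0.
Proof. by rewrite /b0 !mulmxA trC_projP !mul0mx. Qed.

Lemma shift_sym lam : (H - lam%:M)^T = H - lam%:M.
Proof.
by rewrite linearB /= tr_scalar_mx !trmx_mul A_sym projP_sym !mulmxA.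
Qed.

Lemma trC_shift lam : C^T *m (H - lam%:M) = - lam *: C^T.
Proof.
by rewrite mulmxBr !mulmxA trC_projP !mul0mx sub0r mul_mx_scalar scaleNr.
Qed.

Lemma gam_sqr : g ^+ 2 = 1 - dot v0 v0.
Proof.
rewrite sqr_sqrtr // subr_ge0.
rewrite -[sqnorm _]sqr_sqrtr ?dot_ge0 //.
by rewrite expr_le1 ?sqrtr_ge0 // ltW.
Qed.

Lemma gam_gt0 : 0 < g.
Proof.
rewrite /gam sqrtr_gt0 subr_gt0 -[sqnorm _]sqr_sqrtr ?dot_ge0 //.
by rewrite expr_lt1 ?sqrtr_ge0.
Qed.

Lemma dot_n0 x : C^T *m x = 0 -> dot v0 x = 0.
Proof.
by move=> Cx; rewrite /dot /n0 !trmx_mul -!mulmxA Cx !mulmx0 mxE.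
Qed.

Lemma sqnorm_n0D x : C^T *m x = 0 ->
  sqnorm (v0 + x) = 1 - g ^+ 2 + dot x x.
Proof.
move=> Cx; rewrite -[sqnorm _]/(dot (v0 + x) (v0 + x)) gam_sqr dotDr !dotDl.
by rewrite [dot x v0]dotC (dot_n0 Cx); ring.
Qed.

(** The shift by [lam] is added and subtracted freely; on the sphere its compensating term is
    constant. *)
Lemma CRQ_obj_n0D lam x : C^T *m x = 0 ->
  CRQ_obj A (v0 + x) =
  dot v0 (A *m v0) + 2 * dot x r0 + dot x ((H - lam%:M) *m x) + lam * dot x x.
Proof.
move=> Cx; rewrite /CRQ_obj -mulmxA -[LHS]/(dot (v0 + x) (A *m (v0 + x))).
have Px : P *m x = x by exact: projP_id.
have -> : dot x r0 = dot x (A *m v0).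
  by rewrite /b0 -mulmxA dot_mulmx projP_sym Px.
have -> : dot x ((H - lam%:M) *m x) = dot x (A *m x) - lam * dot x x.
  rewrite mulmxBl mul_scalar_mx dotDr dotNr dotZr -!mulmxA Px.
  by rewrite [dot x (P *m _)]dot_mulmx projP_sym Px.
rewrite mulmxDr !dotDr !dotDl.
by rewrite [dot v0 (A *m x)]dot_mulmx A_sym [dot (A *m v0) x]dotC; ring.
Qed.

(* On the sphere the objective gap at [x + e] is the quadratic form of
   [H - lam] at [e]. *)
Lemma CRQ_minimizer_n0D lam x :
    C^T *m x = 0 -> dot x x = g ^+ 2 -> (H - lam%:M) *m x = - r0 ->
    (forall y, C^T *m y = 0 -> 0 <= dot y ((H - lam%:M) *m y)) ->
  CRQ_minimizer A C b (v0 + x).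
Proof.
move=> Cx xx Mx psd; split.
  by split; rewrite ?sqnorm_n0D // ?xx ?subrK // mulmxDr trC_n0 Cx addr0.
move=> w [ww Cw]; pose y := w - v0.
have Cy : C^T *m y = 0 by rewrite mulmxBr Cw trC_n0 subrr.
have wE : w = v0 + y by rewrite addrC subrK.
have yy : dot y y = g ^+ 2.
  by move: ww; rewrite wE sqnorm_n0D // => E; lra.
have := psd (y - x); rewrite mulmxBr Cy Cx subrr => /(_ erefl).
rewrite mulmxBr Mx opprK dotDl !dotDr !dotNl.
have -> : dot x ((H - lam%:M) *m y) = - dot y r0.
  by rewrite dot_mulmx shift_sym Mx dotNl dotC.
rewrite wE !(CRQ_obj_n0D lam) // xx yy Mx dotNr.
lra.
Qed.

(** The columns of [U] are an orthonormal eigenbasis of the null space of C^T, and [r0] lies in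
    their span. Feasible pairs in coordinates lift through [U] to QEP pairs, so [secular_min]
    applies. *)
Lemma QEP_min_shift lam :
    (forall l z, QEP_feasible A C b l z -> lam <= l) ->
  (forall y, C^T *m y = 0 -> 0 <= dot y ((H - lam%:M) *m y)) /\
  exists2 y, (H - lam%:M) *m y = - r0 & dot y y <= g ^+ 2.
Proof.
move=> minlam.
have Hsym : H^T = H by rewrite !trmx_mul A_sym projP_sym mulmxA.
have PH : P *m H = H *m P by rewrite !mulmxA projP_idem -!mulmxA projP_idem.
have [k [U [d [UU UP HU]]]] := sym_spectral projP_sym projP_idem Hsym PH.
have CU : C^T *m U = 0.
  have PU : P *m U = U by rewrite -UP -mulmxA UU mulmx1.
  by rewrite -PU mulmxA trC_projP mul0mx.
have [beta r0E] : exists beta, r0 = U *m beta.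
  by exists (U^T *m r0); rewrite mulmxA UP projP_id ?trC_b0.
have dotU c c' : dot (U *m c) (U *m c') = dot c c'.
  by rewrite dot_mulmx mulmxA UU mul1mx.
have shiftU l c : (H - l%:M) *m (U *m c) = U *m (\col_i ((d 0 i - l) * c i 0)).
  rewrite mulmxBl mulmxA HU mul_scalar_mx scalemxAr -mulmxA -mulmxBr.
  congr (_ *m _); apply/colP => i.
  by rewrite mul_diag_mx !mxE mulrBl.
have [|led ltd sec] :=
  @secular_min R k (fun i => d 0 i) (fun i => beta i 0) g lam gam_gt0.
  move=> l c [[i ci] feas]; apply: (minlam l (U *m \col_j c j)); split.
  - apply: contra ci => /eqP /(congr1 (mulmx U^T)).
    by rewrite mulmxA UU mul1mx mulmx0 => /colP/(_ i); rewrite !mxE => ->.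
  - by rewrite mulmxA CU mul0mx.
  - rewrite !shiftU mulmx_outer r0E dotU scalerA scalemxAr; congr (_ *m _).
    apply/colP => j; have := feas j; rewrite !mxE mulrA -expr2 => ->.
    rewrite dotE -mulrA [beta j 0 * _]mulrC; congr (_ * (_ * _)).
    by apply: eq_bigr => t _; rewrite !mxE.
split=> [y Cy|].
  have [c ->] : exists c, y = U *m c.
    by exists (U^T *m y); rewrite mulmxA UP projP_id.
  rewrite shiftU dotU dotE; apply: sumr_ge0 => i _; rewrite mxE mulrCA.
  by rewrite mulr_ge0 ?subr_ge0 // -expr2 sqr_ge0.
(* A zero denominator comes with a zero numerator, so x / 0 = 0 is harmless. *)
exists (U *m (\col_i - (beta i 0 / (d 0 i - lam)))).
  rewrite shiftU r0E -mulmxN; congr (_ *m _); apply/colP => i; rewrite !mxE.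
  have [->|bi] := eqVneq (beta i 0) 0; first by rewrite mul0r oppr0 mulr0.
  by rewrite mulrN mulrC divfK // subr_eq0 gt_eqF ?ltd.
(* The squared norm of this preimage is [secular lam]. *)
rewrite dotU; apply: le_trans sec; rewrite dotE /secular.
by apply: ler_sum => i _; rewrite !mxE mulrNN -expr2 expr_div_n.
Qed.

End Reduction.

(** * Recovering a CRQopt minimizer from a QEPmin minimizer *)

Theorem theorem2p9 (R : rcfType) (n m : nat) (A : 'M[R]_n) (C : 'M[R]_(n, m))
  (b : 'cV[R]_m)
  (hmn : (m < n)%N)
  (hA : A^T = A)
  (hC : \rank C = m)
  (hn0 : vnorm (n0 C b) < 1)
  (hb0 : b0 A C b != 0)
  (lam : R) (z : 'cV[R]_n)
  (hmin : QEP_minimizer A C b lam z) :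
  let M := projP C *m A *m projP C - lam%:M in
  let s := ((b0 A C b)^T *m z) 0 0 in
  (s != 0 ->
     CRQ_minimizer A C b
       (n0 C b - (gam C b ^+ 2 / s) *: (M *m z))) /\
  (s = 0 -> forall Mdag : 'M[R]_n, is_mpinv M Mdag ->
     let x := - (Mdag *m b0 A C b) in
     vnorm x <= gam C b /\
     CRQ_minimizer A C b
       (n0 C b + x + (Num.sqrt (gam C b ^+ 2 - sqnorm x) / vnorm z) *: z)).
Proof.
case: hmin => -[z_neq0 Cz MMz] minlam M s.
rewrite -/M mulmx_outer -[dot _ z]/s in MMz.
have [psd [y My ley]] := QEP_min_shift hA hC hn0 minlam; rewrite -/M in psd My.
have Msym : M^T = M by exact: shift_sym.
have g_gt0 := gam_gt0 hn0.
have g2_neq0 : gam C b ^+ 2 != 0 by rewrite expf_neq0 // gt_eqF.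
have CM w : C^T *m (M *m w) = - lam *: (C^T *m w).
  by rewrite mulmxA trC_shift // scalemxAl.
split=> [s_neq0|s0 Mdag [MXM XMX MXsym XMsym] x].
  rewrite -scaleNr; apply: (@CRQ_minimizer_n0D _ _ _ _ _ _ hA hC hn0 lam) => //.
  - by rewrite -scalemxAr CM Cz !scaler0.
  (* By symmetry of [M], |Mz|^2 = z^T M^2 z = s^2 / gamma^2, so the scaling gives squared norm
     gamma^2. *)
  - rewrite dotZl dotZr dot_mulmx Msym MMz dotZl dotZl -[dot _ z]/s.
    by field; rewrite s_neq0 gt_eqF.
  - rewrite -scalemxAr MMz !scalerA -scaleN1r; congr (_ *: _).
    by field; rewrite s_neq0 gt_eqF.
(* Here |Mz|^2 = z^T M^2 z = 0, so [z] can be added freely to a solution of M x = -b0. *)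
have Mz : M *m z = 0.
  apply/eqP; rewrite -dot_eq0 dot_mulmx Msym MMz s0 scale0r scaler0.
  by rewrite dot0l.
have xE : x = Mdag *m M *m y by rewrite -mulmxA My mulmxN.
clearbody x.
have Mx : M *m x = - b0 A C b by rewrite xE !mulmxA MXM.
have [w xw] : exists w, x = M *m w.
  exists (Mdag^T *m y); rewrite xE -XMsym trmx_mul Msym.
  by rewrite mulmxA.
(* Applying C^T to M x = -b0 gives lam C^T x = 0; when lam = 0, C^T M = 0 and [x] lies in the range
   of [M]. *)
have Cx : C^T *m x = 0.
  have /eqP : lam *: (C^T *m x) = 0.
    by apply: oppr_inj; rewrite -scaleNr -CM Mx mulmxN trC_b0 // !oppr0.
  rewrite scaler_eq0 => /orP[/eqP l0|/eqP //].
  by rewrite xw CM l0 oppr0 scale0r.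
have xz : dot x z = 0 by rewrite xw dotC dot_mulmx Msym Mz dot0l.
(* [x] is the orthogonal projection of [y] by [Mdag *m M], hence no longer than [y]. *)
have xx_le : dot x x <= gam C b ^+ 2.
  apply: le_trans ley.
  have XMx : Mdag *m M *m x = x by rewrite {1}xE !mulmxA XMX -xE.
  have xy : dot x x = dot x y by rewrite {2}xE dot_mulmx XMsym XMx.
  have := dot_ge0 (y - x); rewrite dotDl !dotDr !dotNl !dotNr opprK.
  by rewrite [dot y x]dotC -xy; lra.
split.
  rewrite -(ger0_norm (ltW g_gt0)) -sqrtr_sqr.
  by rewrite ler_wsqrtr.
have zz_gt0 : 0 < dot z z by rewrite lt0r dot_eq0 z_neq0 dot_ge0.
rewrite -addrA; apply: (@CRQ_minimizer_n0D _ _ _ _ _ _ hA hC hn0 lam) => //.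
- by rewrite mulmxDr Cx -scalemxAr Cz scaler0 addr0.
(* Since [x] lies in the range of [M] and [z] in its kernel, they are orthogonal and Pythagoras
   fills the norm up to gamma. *)
- rewrite dotDl !dotDr !dotZl !dotZr [dot z x]dotC xz !mulr0 add0r addr0.
  rewrite mulrA -expr2 expr_div_n sqr_sqrtr ?subr_ge0 //.
  rewrite [vnorm z ^+ 2]sqr_sqrtr ?dot_ge0 // -[sqnorm z]/(dot z z) divfK ?gt_eqF //.
  by rewrite -[sqnorm x]/(dot x x) addrC subrK.
- by rewrite mulmxDr Mx -scalemxAr Mz scaler0 addr0.
Qed.
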